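(* Let $A$ be a perfect Leibniz algebra over a field $\mathbb{F}$ such that the center of the Lie algebra $A/\mathrm{Leib}(A)$ is trivial. Let $I=\{f\in D(A): \mathrm{Im}(f)\subseteq \mathrm{Leib}(A)\}$. Then for all $n\in\mathbb{N}$ (including $n=0$), the Lie algebra $D^n(D(A)/I)$ can be embedded as a subalgebra of the derivation algebra $D(A/\mathrm{Leib}(A))$, i.e. there is an injective Lie algebra homomorphism $D^n(D(A)/I)\to D(A/\mathrm{Leib}(A))$.
   Context: A (left) Leibniz algebra over a field $\mathbb{F}$ is an $\mathbb{F}$-vector space $A$ (of arbitrary dimension) with a bilinear product $[\ ,\ ]$ such that $[x,[y,z]]=[[x,y],z]+[y,[x,z]]$ for all $x,y,z\in A$. $A$ is perfect if $A=[A,A]$, where $[A,A]$ is the linear span of all products $[x,y]$, $x,y\in A$. The Leibniz kernel $\mathrm{Leib}(A)$ is the linear span of $\{[x,x]:x\in A\}$; it is a two-sided ideal invariant under all derivations and is the smallest ideal $J$ such that $A/J$ is a Lie algebra. A derivation of $A$ is a linear map $f:A\to A$ with $f([x,y])=[f(x),y]+[x,f(y)]$; the space $D(A)$ of all derivations is a Lie algebra under the commutator $[f,g]=fg-gf$. The subspace $I$ is an ideal of the Lie algebra $D(A)$. For a Lie algebra $\mathfrak{g}$, define inductively $D^0(\mathfrak{g})=\mathfrak{g}$ and $D^{n+1}(\mathfrak{g})=D(D^n(\mathfrak{g}))$. *)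

(* Defs.v *)
From HB Require Import structures.
From mathcomp Require Import all_boot all_algebra.
From mathcomp Require Import boolp classical_sets functions.

Set Implicit Arguments.
Unset Strict Implicit.
Unset Printing Implicit Defensive.

Import GRing.Theory.
Local Open Scope ring_scope.
Local Open Scope quotient_scope.
Local Open Scope classical_set_scope.

HB.mixin Record Lmodule_isLeibniz (F : fieldType) A of GRing.Lmodule F A := {
  lbr : A -> A -> A;
  lbr_linearl : forall y, linear (lbr^~ y);
  lbr_linearr : forall x, linear (lbr x);
  lbr_leibniz : forall x y z,
    lbr x (lbr y z) = lbr (lbr x y) z + lbr y (lbr x z)
}.

#[short(type="leibnizAlgType")]
HB.structure Definition LeibnizAlg (F : fieldType) :=
  {A of GRing.Lmodule F A & Lmodule_isLeibniz F A}.

Notation "[br x , y ]" := (lbr x y)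
  (at level 0, x at level 99, y at level 99, format "[br  x ,  y ]") :
  ring_scope.

(* For an alternating bilinear bracket the left Leibniz identity is the Jacobi
   identity, so Lie algebras are the alternating Leibniz algebras. *)
HB.mixin Record Leibniz_isLie (F : fieldType) L of LeibnizAlg F L := {
  lbrxx : forall x : L, [br x, x] = 0
}.

#[short(type="lieAlgType")]
HB.structure Definition LieAlg (F : fieldType) :=
  {L of LeibnizAlg F L & Leibniz_isLie F L}.

Section LeibnizTheory.
Variables (F : fieldType) (A : leibnizAlgType F).
Implicit Types x y z : A.

HB.instance Definition _ x :=
  GRing.isLinear.Build F A A _ (lbr x) (lbr_linearr x).

Lemma lbrDr x y z : [br x, y + z] = [br x, y] + [br x, z].
Proof. exact: raddfD. Qed.
Lemma lbrBr x y z : [br x, y - z] = [br x, y] - [br x, z].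
Proof. exact: raddfB. Qed.
Lemma lbrNr x y : [br x, - y] = - [br x, y].
Proof. exact: raddfN. Qed.
Lemma lbr0r x : [br x, 0] = 0.
Proof. exact: raddf0. Qed.
Lemma lbrZr x c y : [br x, c *: y] = c *: [br x, y].
Proof. exact: linearZ. Qed.

Definition lbrr y x := [br x, y].
HB.instance Definition _ y :=
  GRing.isLinear.Build F A A _ (lbrr y) (lbr_linearl y).

Lemma lbrDl z x y : [br x + y, z] = [br x, z] + [br y, z].
Proof. exact: (raddfD (lbrr z)). Qed.
Lemma lbrBl z x y : [br x - y, z] = [br x, z] - [br y, z].
Proof. exact: (raddfB (lbrr z)). Qed.
Lemma lbrNl z x : [br - x, z] = - [br x, z].
Proof. exact: (raddfN (lbrr z)). Qed.
Lemma lbr0l x : [br 0, x] = 0.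
Proof. exact: (raddf0 (lbrr x)). Qed.
Lemma lbrZl y c x : [br c *: x, y] = c *: [br x, y].
Proof. exact: (linearZ_LR (lbrr y)). Qed.

End LeibnizTheory.

Section Span.
Variables (F : fieldType) (V : lmodType F).

Definition lspan (S : set V) : {pred V} := fun x =>
  `[< exists (n : nat) (c : 'I_n -> F) (v : 'I_n -> V),
        (forall i, S (v i)) /\ x = \sum_(i < n) c i *: v i >].

Variable S : set V.

Lemma lspan_gen x : S x -> x \in lspan S.
Proof.
move=> Sx; apply/asboolP; exists 1%N, (fun=> 1), (fun=> x); split=> //.
by rewrite big_ord1 scale1r.
Qed.

Lemma lspan_closed : subsemimod_closed (lspan S).
Proof.
split; first split.
- by apply/asboolP; exists 0%N, (fun=> 0), (fun=> 0); split=> [[]|] //;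
    rewrite big_ord0.
- move=> _ _ /asboolP[m [c [v [Sv ->]]]] /asboolP[n [d [w [Sw ->]]]].
  apply/asboolP.
  exists (m + n)%N, (fun i : 'I_(m + n) => match fintype.split i with inl j => c j | inr j => d j end),
    (fun i : 'I_(m + n) => match fintype.split i with inl j => v j | inr j => w j end).
  split=> [i|]; first by case: fintype.split.
  rewrite big_split_ord /=; congr (_ + _); apply: eq_bigr => i _.
    by rewrite (unsplitK (inl i)).
  by rewrite (unsplitK (inr i)).
- move=> a _ /asboolP[n [c [v [Sv ->]]]].
  apply/asboolP; exists n, (fun i => a * c i), v; split=> //.
  by rewrite scaler_sumr; apply: eq_bigr => i _; rewrite scalerA.
Qed.

HB.instance Definition _ := GRing.isSubmodClosed.Build F V (lspan S) lspan_closed.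

Lemma lspan_ind (P : V -> Prop) :
    P 0 -> (forall c x y, P x -> P y -> P (c *: x + y)) ->
    (forall x, S x -> P x) -> forall x, x \in lspan S -> P x.
Proof.
move=> P0 PD PS _ /asboolP[n [c [v [Sv ->]]]].
elim/big_rec: _ => // i x _ Px; apply: PD => //; exact: PS.
Qed.

End Span.

Definition perfect (F : fieldType) (A : leibnizAlgType F) :=
  forall x : A, x \in lspan [set [br y, z] | y in setT & z in setT].

Definition lie_center (F : fieldType) (L : lieAlgType F) : set L :=
  [set z | forall x, [br z, x] = 0].
Arguments lie_center {F} L.

(* Two-sided ideals. Scaling is part of the mixin because the hierarchy has no
   common parent of Algebra.OppClosed and GRing.SubmodClosed to inherit from. *)
HB.mixin Record isLbrIdeal (F : fieldType) (A : leibnizAlgType F)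
    (J : A -> bool) := {
  ideal_scale : forall (c : F) x,
    x \in (J : {pred A}) -> c *: x \in (J : {pred A});
  ideal_lbrr : forall x y, y \in (J : {pred A}) -> [br x, y] \in (J : {pred A});
  ideal_lbrl : forall x y, x \in (J : {pred A}) -> [br x, y] \in (J : {pred A})
}.

#[short(type="lbrIdeal")]
HB.structure Definition LbrIdeal (F : fieldType) (A : leibnizAlgType F) :=
  {J of GRing.ZmodClosed A J & isLbrIdeal F A J}.

Definition lquot (F : fieldType) (A : leibnizAlgType F) (J : lbrIdeal A) :=
  Quotient.quot J.

Section Quot.
Variables (F : fieldType) (A : leibnizAlgType F) (J : lbrIdeal A).
Local Notation Q := (lquot J).

HB.instance Definition _ := GRing.Zmodule.on Q.
HB.instance Definition _ := ZmodQuotient.on Q.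

Lemma lquotW (P : Q -> Prop) : (forall x, P (\pi_Q x)) -> forall v, P v.
Proof. exact: quotW. Qed.

Lemma lquot_eqP (x y : A) : reflect (x = y %[mod Q]) (x - y \in J).
Proof. by rewrite Quotient.idealrBE; apply: eqP. Qed.

Lemma repr_lquot (x : A) : repr (\pi_Q x) - x \in J.
Proof. by apply/lquot_eqP; rewrite reprK. Qed.

Lemma lquot_piD (x y : A) : \pi_Q (x + y) = \pi_Q x + \pi_Q y.
Proof. exact: raddfD. Qed.

Definition lquot_scale (c : F) (x : Q) : Q := \pi_Q (c *: repr x).
Definition lquot_lbr (x y : Q) : Q := \pi_Q [br repr x, repr y].

Lemma lquot_scaleE c (x : A) : lquot_scale c (\pi_Q x) = \pi_Q (c *: x).
Proof. by apply/lquot_eqP; rewrite -scalerBr; exact/ideal_scale/repr_lquot. Qed.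

Lemma lquot_lbrE (x y : A) : lquot_lbr (\pi_Q x) (\pi_Q y) = \pi_Q [br x, y].
Proof.
apply/lquot_eqP; set x' := repr _; set y' := repr _.
have -> : [br x', y'] - [br x, y] = [br x' - x, y'] + [br x, y' - y].
  by rewrite lbrBl lbrBr addrA subrK.
by apply: rpredD; [apply: ideal_lbrl|apply: ideal_lbrr]; exact: repr_lquot.
Qed.

Lemma lquot_scaleA a b v :
  lquot_scale a (lquot_scale b v) = lquot_scale (a * b) v.
Proof. by elim/lquotW: v => x; rewrite !lquot_scaleE scalerA. Qed.
Lemma lquot_scale1 : left_id 1 lquot_scale.
Proof. by elim/lquotW => x; rewrite !lquot_scaleE scale1r. Qed.
Lemma lquot_scaleDr : right_distributive lquot_scale +%R.
Proof.
move=> a; elim/lquotW => x; elim/lquotW => y.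
by rewrite -lquot_piD !lquot_scaleE scalerDr lquot_piD.
Qed.
Lemma lquot_scaleDl v : {morph lquot_scale^~ v : a b / a + b}.
Proof.
by elim/lquotW: v => x a b; rewrite !lquot_scaleE scalerDl lquot_piD.
Qed.

HB.instance Definition _ := GRing.Zmodule_isLmodule.Build F Q
  lquot_scaleA lquot_scale1 lquot_scaleDr lquot_scaleDl.

Lemma lquot_piZ c (x : A) : \pi_Q (c *: x) = c *: \pi_Q x.
Proof. by rewrite -lquot_scaleE. Qed.

Lemma lquot_lbr_linearl (y : Q) : linear (lquot_lbr^~ y).
Proof.
elim/lquotW: y => z a; elim/lquotW => x; elim/lquotW => y.
by rewrite -lquot_piZ -lquot_piD !lquot_lbrE lbrDl lbrZl lquot_piD lquot_piZ.
Qed.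
Lemma lquot_lbr_linearr (x : Q) : linear (lquot_lbr x).
Proof.
elim/lquotW: x => z a; elim/lquotW => x; elim/lquotW => y.
by rewrite -lquot_piZ -lquot_piD !lquot_lbrE lbrDr lbrZr lquot_piD lquot_piZ.
Qed.
Lemma lquot_lbr_leibniz (x y z : Q) :
  lquot_lbr x (lquot_lbr y z) =
  lquot_lbr (lquot_lbr x y) z + lquot_lbr y (lquot_lbr x z).
Proof.
elim/lquotW: x => x; elim/lquotW: y => y; elim/lquotW: z => z.
by rewrite !lquot_lbrE lbr_leibniz lquot_piD.
Qed.

HB.instance Definition _ := Lmodule_isLeibniz.Build F Q
  lquot_lbr_linearl lquot_lbr_linearr lquot_lbr_leibniz.

Lemma lquot_pi_linear : linear \pi_Q.
Proof. by move=> a x y; rewrite lquot_piD lquot_piZ. Qed.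
HB.instance Definition _ := GRing.isLinear.Build F A Q _ \pi_Q lquot_pi_linear.

Lemma lquot_pi_lbr (x y : A) : \pi_Q [br x, y] = [br \pi_Q x, \pi_Q y].
Proof. by rewrite -lquot_lbrE. Qed.

Lemma lquot_pi0P (x : A) : reflect (\pi_Q x = 0) (x \in J).
Proof.
by rewrite -[x in x \in _]subr0 -[0 in RHS](raddf0 \pi_Q); apply: lquot_eqP.
Qed.

End Quot.

Section LieQuot.
Variables (F : fieldType) (L : lieAlgType F) (J : lbrIdeal L).

Lemma lquot_lbrxx (x : lquot J) : [br x, x] = 0.
Proof. by elim/lquotW: x => x; rewrite -lquot_pi_lbr lbrxx raddf0. Qed.

HB.instance Definition _ := Leibniz_isLie.Build F (lquot J) lquot_lbrxx.
End LieQuot.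

Definition derivation (F : fieldType) (A : leibnizAlgType F) : {pred A -> A} :=
  fun f => `[< linear f /\
               forall x y, f [br x, y] = [br f x, y] + [br x, f y] >].
Arguments derivation {F} A.

Section Derivations.
Variables (F : fieldType) (A : leibnizAlgType F).

Lemma derivation_closed : subsemimod_closed (derivation A).
Proof.
split; first split.
- apply/asboolP; split=> [a x y|x y].
    by rewrite /= scaler0 addr0.
  by rewrite /= lbr0l lbr0r addr0.
- move=> f g /asboolP[fL fD] /asboolP[gL gD]; apply/asboolP; split.
    move=> a x y.
    by rewrite !addrfctE !fL gL scalerDr addrACA.
  by move=> x y; rewrite !addrfctE fD gD lbrDl lbrDr addrACA.
- move=> a f /asboolP[fL fD]; apply/asboolP; split.
    by move=> b x y; rewrite scalrfctE !fL scalerDr !scalerA mulrC.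
  by move=> x y; rewrite scalrfctE fD scalerDr lbrZl lbrZr.
Qed.

HB.instance Definition _ :=
  GRing.isSubmodClosed.Build F (A -> A) (derivation A) derivation_closed.

Record der := Der { derfun :> A -> A; derfunP : derfun \in derivation A }.

HB.instance Definition _ := [isSub for derfun].
HB.instance Definition _ := [Choice of der by <:].
HB.instance Definition _ := [SubChoice_isSubLmodule of der by <:].

Implicit Types f g : der.

Lemma der_linear f : linear f.
Proof. by have /asboolP[] := derfunP f. Qed.
HB.instance Definition _ f :=
  GRing.isLinear.Build F A A _ (derfun f) (der_linear f).

Lemma der_lbr f x y : f [br x, y] = [br f x, y] + [br x, f y].
Proof. by have /asboolP[_] := derfunP f. Qed.

Lemma derP f g : f =1 g <-> f = g.
Proof. by split=> [fg|->//]; apply/val_inj/funext. Qed.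

Lemma derDE f g x : (f + g) x = f x + g x. Proof. by []. Qed.
Lemma derZE c f x : (c *: f) x = c *: f x. Proof. by []. Qed.
Lemma der0E x : (0 : der) x = 0. Proof. by []. Qed.

Lemma der_comm_subproof f g : (fun x => f (g x) - g (f x)) \in derivation A.
Proof.
apply/asboolP; split=> [a x y|x y].
  by rewrite (der_linear g a x) (der_linear f a (g x)) (der_linear f a x)
    (der_linear g a (f x)) scalerBr opprD addrACA.
rewrite !der_lbr (raddfD f) (raddfD g) /= !der_lbr lbrBl lbrBr.
set a := [br f (g x), y]; set b := [br x, f (g y)].
set a' := [br g (f x), y]; set b' := [br x, g (f y)].
rewrite opprD !opprD !addrA.
by rewrite [LHS](ACl ((1*5)*(4*8)*(2*7)*(3*6)))%AC /= !subrr !addr0 addrA.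
Qed.

Definition der_comm f g : der := Der (der_comm_subproof f g).

Lemma der_comm_linearl g : linear (der_comm^~ g).
Proof.
move=> a f h; apply/derP => x.
change (a *: f (g x) + h (g x) - g (a *: f x + h x) =
        a *: (f (g x) - g (f x)) + (h (g x) - g (h x))).
by rewrite (der_linear g) scalerBr opprD addrACA.
Qed.

Lemma der_comm_linearr f : linear (der_comm f).
Proof.
move=> a g h; apply/derP => x.
change (f (a *: g x + h x) - (a *: g (f x) + h (f x)) =
        a *: (f (g x) - g (f x)) + (f (h x) - h (f x))).
by rewrite (der_linear f) scalerBr opprD addrACA.
Qed.

Lemma der_comm_leibniz f g h :
  der_comm f (der_comm g h) =
  der_comm (der_comm f g) h + der_comm g (der_comm f h).
Proof.
apply/derP => x.
change (f (g (h x) - h (g x)) - (g (h (f x)) - h (g (f x))) =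
        f (g (h x)) - g (f (h x)) - h (f (g x) - g (f x)) +
        (g (f (h x) - h (f x)) - (f (h (g x)) - h (f (g x))))).
rewrite (raddfB f) (raddfB g) (raddfB h) /= !opprB !addrA.
by rewrite [RHS](ACl ((1*8)*3*6*(5*2)*(7*4)))%AC /= !subrr !addr0.
Qed.

HB.instance Definition _ := Lmodule_isLeibniz.Build F der
  der_comm_linearl der_comm_linearr der_comm_leibniz.

Lemma der_lbrxx f : [br f, f] = 0.
Proof. by apply/derP => x; rewrite /lbr/= subrr. Qed.

HB.instance Definition _ := Leibniz_isLie.Build F der der_lbrxx.

Lemma der_lbrE f g x : [br f, g] x = f (g x) - g (f x).
Proof. by []. Qed.

End Derivations.

(* D^n(L). *)
Fixpoint iter_der (F : fieldType) (L : lieAlgType F) (n : nat) : lieAlgType F :=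
  if n is n'.+1 then der (iter_der L n') else L.

Section LeibnizKernel.
Variables (F : fieldType) (A : leibnizAlgType F).

Definition Leib : {pred A} := lspan [set [br x, x] | x in setT].

HB.instance Definition _ := GRing.ZmodClosed.on Leib.
HB.instance Definition _ := GRing.SubmodClosed.on Leib.

Lemma Leib_sq (x : A) : [br x, x] \in Leib.
Proof. by apply: lspan_gen; exists x. Qed.

Lemma Leib_der (f : der A) (x : A) : x \in Leib -> f x \in Leib.
Proof.
move: x; apply: lspan_ind => [|c x y Ix Iy|_ [x _ <-]].
- by rewrite raddf0 rpred0.
- by rewrite linearP rpredD// rpredZ.
have -> : f [br x, x] = [br f x + x, f x + x] - [br f x, f x] - [br x, x].
  rewrite der_lbr lbrDl !lbrDr !addrA.
  by rewrite [RHS](ACl (2*3*(1*5)*(4*6)))%AC /= !subrr !addr0.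
by rewrite !rpredB ?Leib_sq.
Qed.

Lemma lbr_derivation (x : A) : lbr x \in derivation A.
Proof.
by apply/asboolP; split=> [|y z]; [exact: lbr_linearr|exact: lbr_leibniz].
Qed.

Lemma Leib_lbrr (x y : A) : y \in Leib -> [br x, y] \in Leib.
Proof. exact: (Leib_der (Der (lbr_derivation x))). Qed.

Lemma lbr_Leib (x y : A) : x \in Leib -> [br x, y] = 0.
Proof.
move: x; apply: lspan_ind => [|c u v Iu Iv|_ [x _ <-]].
- by rewrite lbr0l.
- by rewrite lbrDl lbrZl Iu Iv scaler0 addr0.
by apply: (addIr [br x, [br x, y]]); rewrite add0r -lbr_leibniz.
Qed.

Lemma Leib_lbrl (x y : A) : x \in Leib -> [br x, y] \in Leib.
Proof. by move=> /lbr_Leib->; rewrite rpred0. Qed.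

HB.instance Definition _ :=
  isLbrIdeal.Build F A Leib (@rpredZ F A Leib) Leib_lbrr Leib_lbrl.

(* A / Leib A; a name of its own carries the Lie structure, since lquot Leib is
   only a Leibniz algebra when A is. *)
Definition lieize := lquot Leib.

HB.instance Definition _ := LeibnizAlg.on lieize.

Lemma lieize_lbrxx (x : lieize) : [br x, x] = 0.
Proof.
elim/lquotW: x => x; rewrite -[LHS]lquot_pi_lbr.
by apply/lquot_pi0P; exact: Leib_sq.
Qed.

HB.instance Definition _ := Leibniz_isLie.Build F lieize lieize_lbrxx.

Definition der_Leib : {pred der A} := fun f => `[< forall x, f x \in Leib >].

Lemma der_Leib_closed : subsemimod_closed der_Leib.
Proof.
split; first split.
- by apply/asboolP => x; rewrite der0E rpred0.
- move=> f g /asboolP fI /asboolP gI; apply/asboolP => x.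
  by rewrite derDE rpredD.
- by move=> a f /asboolP fI; apply/asboolP => x; rewrite derZE rpredZ.
Qed.

HB.instance Definition _ :=
  GRing.isSubmodClosed.Build F (der A) der_Leib der_Leib_closed.

Lemma der_Leib_lbrr (f g : der A) : g \in der_Leib -> [br f, g] \in der_Leib.
Proof.
move=> /asboolP gI; apply/asboolP => x.
by rewrite der_lbrE; apply: rpredB; [exact/Leib_der/gI|exact: gI].
Qed.

Lemma der_Leib_lbrl (f g : der A) : f \in der_Leib -> [br f, g] \in der_Leib.
Proof.
move=> /asboolP fI; apply/asboolP => x.
by rewrite der_lbrE; apply: rpredB; [exact: fI|exact/Leib_der/fI].
Qed.

HB.instance Definition _ :=
  isLbrIdeal.Build F (der A) der_Leib
    (@rpredZ F (der A) der_Leib) der_Leib_lbrr der_Leib_lbrl.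

End LeibnizKernel.

Arguments Leib {F} A.
Arguments lieize {F} A.
Arguments der_Leib {F} A.

Definition lie_embeds (F : fieldType) (L M : lieAlgType F) :=
  exists phi : {linear L -> M},
    injective phi /\ {morph phi : x y / [br x, y]}.

(* Main.v *)
From HB Require Import structures.
Require Import Defs.
From mathcomp Require Import all_boot all_algebra.
From mathcomp Require Import boolp classical_sets functions.

(** Write L for A / Leib A: it is a perfect Lie algebra with trivial center.
    The proof is an induction over Lie algebras M that sit between the inner
    and all derivations of L, that is, ad L <= M <= D(L).

    A derivation of A preserves Leib A, hence descends to L; it descends to 0
    exactly when its image lies in Leib A.  So D(A)/I embeds in D(L), and the
    left multiplications of A are sent onto ad L ([der_quot_inner_extension]).

    If ad L <= M <= D(L), then D(M) is again such an algebra
    ([inner_extension_der]).  Indeed ad L is an ideal of M because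
    [m, ad x] = ad (m x), and it is perfect, so a derivation d of M maps
    ad L = [ad L, ad L] into [d (ad L), ad L] + [ad L, d (ad L)] <= ad L.  As L
    has no center, L is isomorphic to ad L, and restricting d to ad L gives a
    derivation of L.  If this restriction vanishes, then for all m in M and x in
    L, 0 = d [m, ad x] = [d m, ad x] = ad ((d m) x), whence d m = 0.  Finally the
    restriction of the inner derivation of M at m is m itself, so the image of
    D(M) in D(L) contains M, and a fortiori ad L. *)

Import GRing.Theory.
Local Open Scope ring_scope.
Local Open Scope classical_set_scope.

Lemma lie_lbrC {F : fieldType} {L : lieAlgType F} (x y : L) :
  [br x, y] = - [br y, x].
Proof.
apply/eqP; rewrite -addr_eq0; apply/eqP.
by have := lbrxx (x + y); rewrite lbrDl !lbrDr !lbrxx add0r addr0.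
Qed.

Definition inner_der {F : fieldType} {A : leibnizAlgType F} (x : A) : der A :=
  Der (lbr_derivation x).

Lemma der_lbr_inner {F : fieldType} {A : leibnizAlgType F} (f : der A) (x : A) :
  [br f, inner_der x] = inner_der (f x).
Proof. by apply/derP => y; rewrite der_lbrE /= der_lbr addrK. Qed.

Lemma inner_der_linear {F : fieldType} {A : leibnizAlgType F} :
  linear (@inner_der F A).
Proof. by move=> c x y; apply/derP => z /=; rewrite lbrDl lbrZl. Qed.

Lemma inner_der_inj {F : fieldType} {L : lieAlgType F} :
  lie_center L = [set 0] -> injective (@inner_der F L).
Proof.
move=> ZL x y /derP xy; apply/eqP; rewrite -subr_eq0; apply/eqP.
suff: lie_center L (x - y) by rewrite ZL.
by move=> z; rewrite lbrBl; apply/eqP; rewrite subr_eq0; apply/eqP/xy.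
Qed.

(** M is isomorphic to an algebra between ad L and D(L).  Remembering that ad L
    is reached strengthens [lie_embeds] into a property that passes from M to
    D(M). *)
Definition inner_extension {F : fieldType} (L M : lieAlgType F) :=
  exists phi : {linear M -> der L},
    [/\ injective phi, {morph phi : x y / [br x, y]}
      & forall x, exists m, phi m = inner_der x].

Section DerivationsOfInnerExtension.
Context {F : fieldType} {L M : lieAlgType F}.
Hypotheses (pL : perfect L) (ZL : lie_center L = [set 0]).
Variable phi : {linear M -> der L}.
Hypotheses (phi_inj : injective phi) (phi_lbr : {morph phi : x y / [br x, y]}).

(** The lift of ad to M, as a bare function: linearity and compatibility with brackets are
    inherited from ad, because [phi] is injective. *)
Variable j : L -> M.
Hypothesis phi_j : forall x, phi (j x) = inner_der x.

Lemma incl_inj : injective j.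
Proof.
by move=> x y jxy; apply: (inner_der_inj ZL); rewrite -!phi_j jxy.
Qed.

Lemma incl_linear c x y : j (c *: x + y) = c *: j x + j y.
Proof. by apply: phi_inj; rewrite linearP !phi_j inner_der_linear. Qed.

(** This is [m, ad x] = ad (m x), read through [phi]: the image of L is an ideal
    of M, on which M acts by the derivations [phi m]. *)
Lemma lbr_incl m x : [br m, j x] = j (phi m x).
Proof. by apply: phi_inj; rewrite phi_lbr !phi_j der_lbr_inner. Qed.

Lemma incl_lbr x y : j [br x, y] = [br j x, j y].
Proof. by rewrite lbr_incl phi_j. Qed.

(** By the Leibniz rule a derivation sends brackets of elements of an ideal back
    into the ideal; as L is perfect, such brackets span its image. *)
Lemma der_incl (d : der M) x : exists y, j y = d (j x).
Proof.
move: x (pL x); apply: lspan_ind => [|c x y [x' jx'] [y' jy']|_ [y _ [z _ <-]]].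
- by exists 0; have := incl_linear (-1) 0 0;
    rewrite scaler0 addr0 scaleN1r addNr => ->; rewrite raddf0.
- by exists (c *: x' + y'); rewrite !incl_linear linearP jx' jy'.
(* d [j y, j z] = [d (j y), j z] - [d (j z), j y], and both brackets are given
   by the action of M on L. *)
exists (- 1 *: phi (d (j z)) y + phi (d (j y)) z).
rewrite incl_linear scaleN1r -!lbr_incl incl_lbr der_lbr addrC.
by rewrite -(lie_lbrC (j y)).
Qed.

Section Restriction.
(** The restrictions of the derivations of M to the ideal L; [der_incl] provides
    them one value at a time, and the equation below determines them because [j]
    is injective. *)
Variable r : der M -> L -> L.
Hypothesis j_r : forall d x, j (r d x) = d (j x).

Lemma restr_derivation d : r d \in derivation L.
Proof.
apply/asboolP; split=> [c x y|x y]; apply: incl_inj.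
  by rewrite j_r !incl_linear linearP !j_r.
rewrite -[[br r d x, y]]scale1r incl_linear scale1r.
by rewrite j_r !incl_lbr der_lbr !j_r.
Qed.

Definition restr_der d : der L := Der (restr_derivation d).

Lemma restr_linear : linear restr_der.
Proof.
move=> c d e; apply/derP => x; apply: incl_inj.
by rewrite derDE derZE incl_linear !j_r derDE derZE.
Qed.

Lemma restr_lbr : {morph restr_der : d e / [br d, e]}.
Proof.
move=> d e; apply/derP => x; apply: incl_inj.
rewrite der_lbrE addrC -scaleN1r incl_linear !j_r scaleN1r.
by rewrite der_lbrE addrC.
Qed.

(** The centralizer of L in M is zero, because M acts faithfully on L.  If d and
    e agree on L, then d m - e m centralizes L, since the Leibniz rule expresses
    [d m, j x] through the values of d on L. *)
Lemma restr_inj : injective restr_der.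
Proof.
move=> d e /derP de; apply/derP => m; apply/phi_inj/derP => x; apply: incl_inj.
have dej y : d (j y) = e (j y) by rewrite -!j_r; congr j; exact: de.
rewrite -!lbr_incl; apply: (addIr [br m, d (j x)]).
by rewrite -der_lbr dej -der_lbr lbr_incl dej.
Qed.

Lemma restr_inner m : restr_der (inner_der m) = phi m.
Proof. by apply/derP => x; apply: incl_inj; rewrite j_r /= lbr_incl. Qed.

End Restriction.
End DerivationsOfInnerExtension.

Lemma inner_extension_der {F : fieldType} {L M : lieAlgType F} :
  perfect L -> lie_center L = [set 0] ->
  inner_extension L M -> inner_extension L (der M).
Proof.
move=> pL ZL [phi [phi_inj phi_lbr /choice[j phi_j]]].
have /choice[r j_r] (d : der M) : exists rd, forall x, j (rd x) = d (j x).
  have /choice[rd j_rd] := der_incl pL _ phi_inj phi_lbr _ phi_j d.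
  by exists rd.
pose psi := restr_der ZL phi phi_inj phi_lbr j phi_j r j_r.
have psi_lin : linear psi by exact: restr_linear.
pose psiL : {linear der M -> der L} :=
  HB.pack psi (GRing.isLinear.Build F _ _ _ psi psi_lin).
exists psiL; split=> [||x]; [exact: restr_inj|exact: restr_lbr|].
by exists (inner_der (j x)); rewrite -phi_j; exact: restr_inner.
Qed.

Section LeibnizQuotient.
Context {F : fieldType} {A : leibnizAlgType F}.
Local Notation L := (lieize A).
Local Notation DI := (lquot (der_Leib A)).
Local Notation piL := (\pi_(lquot (Leib A)))%qT.
Local Notation piD := (\pi_DI)%qT.

Lemma perfect_lieize : perfect A -> perfect L.
Proof.
move=> pA; elim/lquotW => x.
move: x (pA x); apply: lspan_ind => [|c x y Px Py|_ [y _ [z _ <-]]].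
- by rewrite raddf0 rpred0.
- by rewrite linearP rpredD ?rpredZ.
by apply: lspan_gen; exists (piL y) => //; exists (piL z); rewrite ?lquot_pi_lbr.
Qed.

Definition induced_fun (v : DI) (x : L) : L := piL (repr v (repr x)).

(** Both choices of representatives are harmless: derivations preserve Leib A,
    and two derivations congruent modulo I differ by values in Leib A. *)
Lemma induced_funE (f : der A) (x : A) :
  induced_fun (piD f) (piL x) = piL (f x).
Proof.
apply/lquot_eqP; set g := repr _; set y := repr _.
have -> : g y - f x = g (y - x) + (g - f) x.
  by rewrite raddfB /= addrA subrK.
apply: rpredD; first by apply: Leib_der; exact: repr_lquot.
by have /asboolP := repr_lquot (der_Leib A) f; exact.
Qed.

Lemma induced_derivation v : induced_fun v \in derivation L.
Proof.
elim/lquotW: v => f; apply/asboolP; split.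
  move=> c; elim/lquotW => x; elim/lquotW => y.
  by rewrite -[c *: _ + _]linearP !induced_funE !linearP.
elim/lquotW => x; elim/lquotW => y.
rewrite -[[br piL x, piL y]]lquot_pi_lbr !induced_funE der_lbr.
by rewrite raddfD /= !lquot_pi_lbr.
Qed.

Definition induced_der v : der L := Der (induced_derivation v).

Lemma induced_linear : linear induced_der.
Proof.
move=> c; elim/lquotW => f; elim/lquotW => g; apply/derP.
elim/lquotW => x; rewrite -[c *: _ + _]linearP derDE derZE /= !induced_funE.
by rewrite derDE derZE linearP.
Qed.

Lemma induced_lbr : {morph induced_der : v w / [br v, w]}.
Proof.
elim/lquotW => f; elim/lquotW => g; apply/derP; elim/lquotW => x.
(* The inner applications come first: rewriting an outer one would expose the
   representative that it applies to. *)
rewrite -lquot_pi_lbr der_lbrE /= !(induced_funE _ x) !induced_funE.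
by rewrite der_lbrE raddfB.
Qed.

Lemma induced_inj : injective induced_der.
Proof.
elim/lquotW => f; elim/lquotW => g /derP fg; apply/lquot_eqP/asboolP => x.
by apply/lquot_eqP; have := fg (piL x); rewrite /= !induced_funE.
Qed.

Lemma induced_inner x : induced_der (piD (inner_der x)) = inner_der (piL x : L).
Proof.
by apply/derP; elim/lquotW => y; rewrite /= induced_funE /= lquot_pi_lbr.
Qed.

Lemma der_quot_inner_extension : inner_extension L DI.
Proof.
pose psi : {linear DI -> der L} :=
  HB.pack induced_der (GRing.isLinear.Build F _ _ _ induced_der induced_linear).
exists psi; split; [exact: induced_inj|exact: induced_lbr|].
by elim/lquotW => x; exists (piD (inner_der x)); exact: induced_inner.
Qed.

End LeibnizQuotient.

Theorem theorem1p2 (F : fieldType) (A : leibnizAlgType F) :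
  perfect A ->
  lie_center (lieize A) = [set 0] ->
  forall n : nat, lie_embeds (iter_der (lquot (der_Leib A)) n) (der (lieize A)).
Proof.
move=> /perfect_lieize pL ZL n.
suff [phi [phi_inj phi_lbr _]] :
  inner_extension (lieize A) (iter_der (lquot (der_Leib A)) n) by exists phi.
elim: n => [|n IHn]; first exact: der_quot_inner_extension.
exact: inner_extension_der.
Qed.
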